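(* Let $\kappa$ be a cardinal with $2 \leq \kappa \leq \mathfrak{c}$, where $\mathfrak{c} = 2^{\aleph_0}$. Then there exists a branchwise-real tree which is weakly uniformly $\kappa$-branching, rigid, and continuously gradable.
   Context: Let $X$ be a partial order. A branch of $X$ is a maximal chain (linearly ordered subset). A tree order is a partial order $X$ such that (1) for every $x \in X$ the set $\{y \in X \mid y \leq x\}$ is linearly ordered, and (2) $X$ has a minimum element, its root. A branchwise-real tree is a tree order $X$ such that (a) every branch of $X$ is order-isomorphic to a real interval, and (b) for any $x,y \in X$ the set $\{z \in X \mid z \leq x \text{ and } z \leq y\}$ has a maximum element. For $x$ in a tree order $X$, a component above $x$ is an equivalence class of $\{y \in X \mid y > x\}$ under the relation: $y \sim_x z$ if and only if there is $w > x$ with $w \leq y$ and $w \leq z$. The degree $\deg(x)$ of $x$ is the number (cardinality of the set) of components above $x$. The point $x$ is branching if $\deg(x) > 1$. A tree order is weakly uniformly $\kappa$-branching if every branching point has degree $\kappa$. A tree order is rigid if its only order-automorphism (order-preserving bijection to itself with order-preserving inverse) is the identity. A continuous grading of a branchwise-real tree $X$ is a function $\ell \colon X \to \mathbb{R}$ such that $x < y$ implies $\ell(x) < \ell(y)$, and such that for all $x<y$ in $X$ the restriction of $\ell$ to $[x,y] = \{z \in X \mid x \leq z \leq y\}$ is an order-isomorphism onto the real interval $[\ell(x),\ell(y)]$. $X$ is continuously gradable if it admits a continuous grading. *)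

(* Defs.v *)
From mathcomp Require Export all_boot all_order all_algebra.
From mathcomp Require Export all_classical reals normedtype.

Set Implicit Arguments.
Unset Strict Implicit.
Unset Printing Implicit Defensive.

Local Open Scope classical_set_scope.
Local Open Scope card_scope.
Local Open Scope order_scope.

Definition order_iso_on d1 d2 (T : porderType d1) (U : porderType d2)
    (A : set T) (B : set U) (f : T -> U) : Prop :=
  set_bij A B f /\ {in A &, {mono f : x y / x <= y}}.

(* Real intervals are nondegenerate: allowing one-point intervals would only
   add the one-point order to the branchwise-real trees, since in any other
   order with a minimum every maximal chain has at least two points. *)
Definition real_interval (R : realType) (I : set R) : Prop :=
  is_interval I /\ exists a b : R, [/\ I a, I b & a < b].

Section Trees.
Variables (d : Order.disp_t) (X : porderType d).
Implicit Types (x y z w : X) (A B C : set X).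

Definition chain A : Prop := total_on A <=%O.

Definition branch B : Prop :=
  chain B /\ forall C, chain C -> B `<=` C -> C = B.

Definition tree_order : Prop :=
  (forall x, chain [set y | y <= x]) /\ (exists r, forall x, r <= x).

Definition branchwise_real_tree (R : realType) : Prop :=
  [/\ tree_order,
      forall B, branch B ->
        exists (I : set R) (f : X -> R), real_interval I /\ order_iso_on B I f
    & forall x y, exists m,
        [/\ m <= x, m <= y & forall z, z <= x -> z <= y -> z <= m] ].

Definition same_component x y z : Prop := exists w, [/\ x < w, w <= y & w <= z].

Definition components x : set (set X) :=
  [set C | exists2 y, x < y & C = [set z | x < z /\ same_component x y z]].

Definition branching x : Prop := `I_2 #<= components x.

(* The cardinal kappa is represented by a type K of that cardinality. *)
Definition weakly_uniformly_branching (K : Type) : Prop :=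
  forall x, branching x -> components x #= [set: K].

Definition rigid : Prop :=
  forall f g : X -> X, cancel f g -> cancel g f ->
    {homo f : x y / x <= y} -> {homo g : x y / x <= y} -> forall x, f x = x.

Definition continuous_grading (R : realType) (l : X -> R) : Prop :=
  {homo l : x y / x < y} /\
  forall x y, x < y -> order_iso_on [set z | x <= z <= y] `[l x, l y] l.

Definition continuously_gradable (R : realType) : Prop :=
  exists l : X -> R, continuous_grading l.

End Trees.

Arguments branchwise_real_tree {d} X R.
Arguments tree_order {d} X.
Arguments weakly_uniformly_branching {d} X K.
Arguments rigid {d} X.
Arguments continuously_gradable {d} X R.

(* Main.v *)
Require Import Defs.
From HB Require Import structures.
From mathcomp Require Import zify lra.

(** The tree consists of histories of a traveller. A history of height [h] is a
    labelling [p] of the reals by elements of [K], with a default label [k0]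
    everywhere except at isolated positions in (0, h), the jumps; one history is
    below another if it is an initial segment of it. Climbing with the default
    label means staying on the current path, and a jump with label [k <> k0]
    means leaving it for the side path [k]. Any such family of histories that is
    closed under initial segments is a tree in which meets exist and in which
    the height is a continuous grading; every maximal chain is then isomorphic
    to its set of heights, which is an interval ([branch_interval]).

    What makes the tree rigid is the choice of the positions at which a jump is
    allowed. They are the branching points, all of degree [K], since isolated
    jumps leave exactly one component for each label ([card_components]). On the
    path that starts with the last jump, at height [a], the coordinate
    u = -1/(t - a) identifies the heights t > a with the negative reals, and a
    jump at t is forbidden iff u lies in a set [pattern S] of rationals. Here [S]
    is a set of natural numbers that encodes the whole history up to and
    including that last jump ([code_inj]; this is where the assumption that [K]
    injects into [nat -> bool] enters). As only rational values of u are
    forbidden, branching points are dense ([branching_dense]).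

    The pattern is made so that [S] can be read off from the order alone, in
    every neighbourhood of u = -oo, that is, arbitrarily close above the jump.
    Between two consecutive blocks in which all rationals are forbidden there are
    finitely many forbidden points, and [n] belongs to [S] iff runs of exactly
    [n] points occur arbitrarily far out ([pattern_run_sound],
    [pattern_run_complete]). Above any later point of the path, on the other
    hand, no run occurs nearby ([pattern_no_run]).

    Let now f be an automorphism and x a branching point. A side component above
    x has the runs that encode the history x followed by the jump into that
    component. Its image is a component above f x with the same runs; it cannot be
    the continuation of the path through f x, which has none, so it is a side
    component, and its code is that of f x followed by a jump. Both histories are
    therefore equal, and so are the heights of their last jumps, whence f x = x.
    An automorphism that fixes a dense set of points of a tree with meets is the
    identity ([identity_of_dense_fixed]). *)

Set Implicit Arguments.
Unset Strict Implicit.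
Unset Printing Implicit Defensive.

Import Order.TTheory GRing.Theory Num.Theory.

Local Open Scope order_scope.
Local Open Scope classical_set_scope.
Local Open Scope card_scope.

(** * Runs of isolated points in ordered sets *)

Definition convex_set d (T : porderType d) (A : set T) :=
  forall y z v, A y -> A z -> y < v -> v < z -> A v.

Lemma convex_set_oo d (T : porderType d) (x w : T) :
  convex_set [set v | x < v < w].
Proof.
move=> y z v /andP[xy _] /andP[_ zw] yv vz /=.
by rewrite (lt_trans xy yv) (lt_trans vz zw).
Qed.

(** A finite set of points has no other trace in a dense order than its
    cardinality. Delimiting the run by limit points of [N] on its two outer sides
    makes it impossible to extend or to shorten it, so that [n] is a property of
    [N]. *)
Definition isolated_run d (T : porderType d) (A N : set T) (n : nat) :=
  exists y z, [/\ A y, A z & y < z] /\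
    [/\ forall y', A y' -> y' < y -> exists2 v, N v & y' < v < y,
        forall z', A z' -> z < z' -> exists2 v, N v & z < v < z'
      & N `&` [set v | y < v < z] #= `I_n].

(** The conditions are stated with explicit inverse maps [e] and [g], because the
    isomorphisms used are restrictions of maps defined everywhere. *)
Lemma isolated_run_iso d1 d2 (T : porderType d1) (U : porderType d2)
    (A N : set T) (B M : set U) (e : T -> U) (g : U -> T) n :
  convex_set A -> convex_set B ->
  (forall v, A v -> B (e v) /\ g (e v) = v) ->
  (forall u, B u -> A (g u) /\ e (g u) = u) ->
  (forall v w, A v -> A w -> v < w -> e v < e w) ->
  (forall u w, B u -> B w -> u < w -> g u < g w) ->
  (forall v, A v -> N v <-> M (e v)) ->
  isolated_run A N n -> isolated_run B M n.
Proof.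
move=> cA cB Ae Bg eh gh NM [y [z [[Ay Az yz] [ly rz card]]]].
have [Bey gey] := Ae _ Ay; have [Bez gez] := Ae _ Az.
exists (e y), (e z); split; first by split=> //; exact: eh.
split.
- move=> y' By' y'y; have [Agy egy] := Bg _ By'.
  have gy : g y' < y by rewrite -gey; exact: gh.
  have [v Nv /andP[v1 v2]] := ly _ Agy gy.
  have Av : A v by apply: cA v1 v2.
  by exists (e v); [exact/NM|rewrite -egy !eh].
- move=> z' Bz' z'z; have [Agz egz] := Bg _ Bz'.
  have gz : z < g z' by rewrite -gez; exact: gh.
  have [v Nv /andP[v1 v2]] := rz _ Agz gz.
  have Av : A v by apply: cA v1 v2.
  by exists (e v); [exact/NM|rewrite -egz !eh].
- have -> : M `&` [set u | e y < u < e z] = e @` (N `&` [set v | y < v < z]).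
    apply/seteqP; split=> [u [Mu /andP[u1 u2]]|_ [v [Nv /andP[v1 v2]] <-]].
      have Bu : B u by apply: cB u1 u2.
      have [Agu egu] := Bg _ Bu.
      exists (g u) => //; split; first by apply/NM; rewrite ?egu.
      by rewrite /= -{1}gey -{1}gez !gh.
    have Av : A v by apply: cA v1 v2.
    by split; [exact/NM|rewrite /= !eh].
  apply: card_eq_trans card; apply: inj_card_eq => v w.
  rewrite !inE => -[_ /andP[v1 v2]] [_ /andP[w1 w2]] evw.
  have Av : A v by apply: cA v1 v2.
  have Aw : A w by apply: cA w1 w2.
  by rewrite -(Ae _ Av).2 evw (Ae _ Aw).2.
Qed.

Lemma card_ge2_neq (T : Type) (A : set T) :
  `I_2 #<= A -> exists a b, [/\ A a, A b & a <> b].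
Proof.
move=> A2; apply: contrapT => nA; suff /(card_le_trans A2) : A #<= `I_1.
  by rewrite card_le_II.
have [->|/set0P[a Aa]] := eqVneq A set0; first exact: card_ge0.
rewrite -(card_le_eqr (card_set1 (x := a))); apply: subset_card_le => b Ab.
by apply: contrapT => /= ab; apply: nA; exists a, b; split=> // /esym.
Qed.

(** * Branches and automorphisms of trees *)

(** As only points close above [x] matter, this depends on [w] only through the
    component above [x] that contains [w]; each component thus gets a set of
    natural numbers, preserved by automorphisms. *)
Definition germ_run d (T : porderType d) (x w : T) (n : nat) : Prop :=
  forall w1 : T, (x < w1)%O -> (w1 <= w)%O -> exists w2, [/\ (x < w2)%O,
    (w2 <= w1)%O & isolated_run [set v | x < v < w2]%O [set v | ~ branching v] n].

Section Trees.
Context {d : Order.disp_t} {X : porderType d}.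
Implicit Types (x y z u v w r : X) (B : set X).

Lemma branch_absorbs B x : branch B ->
  (forall y, B y -> (x <= y) \/ (y <= x)) -> B x.
Proof.
move=> [cB mB] xB; rewrite -(mB (B `|` [set x])); [by right| |by move=> z; left].
move=> u v [Bu|->] [Bv|->]; [exact: cB| |exact: xB|by left].
by rewrite or_comm; exact: xB.
Qed.

Lemma branch_down_closed B x y : tree_order X -> branch B ->
  B x -> y <= x -> B y.
Proof.
move=> [tX _] bB Bx yx; apply: branch_absorbs => // z Bz.
have [xz|zx] := bB.1 _ _ Bx Bz; first by left; exact: le_trans xz.
exact: (tX x).
Qed.

(** A branch of a graded tree contains the root and all points below its
    points, so the grading maps it bijectively onto an interval; the interval
    has more than one point as soon as the tree has. *)
Lemma branch_interval (R : realType) (l : X -> R) B :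
  tree_order X -> (exists x y : X, x < y) -> continuous_grading l -> branch B ->
  exists (I : set R) (f : X -> R), real_interval I /\ order_iso_on B I f.
Proof.
move=> tX [x [y xy]] [lh lc] bB; have [r rmin] := tX.2.
have Br : B r by apply: branch_absorbs => // z _; left.
have [z Bz rz] : exists2 z, B z & r < z.
  apply: contrapT => nB.
  have BE z : B z -> z = r.
    move=> Bz; apply/eqP; apply: contrapT => /negP zr; apply: nB; exists z => //.
    by rewrite lt_neqAle rmin andbT eq_sym.
  have By : B y by apply: branch_absorbs => // z /BE ->; right.
  by move: xy; rewrite (BE _ By) => /lt_geF; rewrite rmin.
have lle u v : u <= v -> (l u <= l v)%R.
  by rewrite le_eqVlt => /predU1P[->//|/lh/ltW].
have lmono u v : B u -> B v -> (l u <= l v)%R = (u <= v).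
  move=> Bu Bv; apply/idP/idP => [luv|]; last exact: lle.
  have [//|] := bB.1 _ _ Bu Bv.
  rewrite le_eqVlt => /predU1P[->//|/lh].
  by rewrite ltNge luv.
exists (l @` B), l; split; last first.
  split; last by move=> u v; rewrite !inE; exact: lmono.
  split; [by move=> u Bu; exists u| |by []].
  move=> u v; rewrite !inE => Bu Bv luv; apply/eqP; rewrite eq_le.
  by rewrite -!lmono// luv lexx.
split; last by exists (l r), (l z); split; [exists r|exists z|exact: lh].
move=> _ _ [u Bu <-] [v Bv <-] t /andP[ut tv].
have := le_trans ut tv; rewrite lmono// le_eqVlt => /predU1P[uv|uv].
  by exists u => //; apply/eqP; rewrite eq_le ut uv.
have [[_ _ surj] _] := lc _ _ uv.
have [|w /= /andP[_ wv] <-] := surj t; first by rewrite /= in_itv /= ut.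
by exists w => //; exact: branch_down_closed Bv wv.
Qed.

Lemma lt_aut (f g : X -> X) : cancel f g -> {homo f : u v / u <= v} ->
  {homo f : u v / u < v}.
Proof.
move=> fK fh u v; rewrite !lt_neqAle => /andP[uv /fh ->].
by rewrite (can_eq fK) uv.
Qed.

Lemma branching_aut (f g : X -> X) x : cancel f g -> cancel g f ->
  {homo f : u v / u <= v} -> {homo g : u v / u <= v} ->
  branching x -> branching (f x).
Proof.
move=> fK gK fh gh; have fl := lt_aut fK fh; have gl := lt_aut gK gh.
move=> bx; apply: card_le_trans bx _.
rewrite -(card_le_eql (inj_card_eq (f := image^~ f) _)); last first.
  move=> C D _ _ /(congr1 (image^~ g)); rewrite /= !image_comp.
  by rewrite (_ : g \o f = id) ?image_id//; apply/funext.
apply: subset_card_le => _ [_ [y xy ->] <-]; exists (f y); first exact: fl.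
apply/seteqP; split=> [_ [z [xz [w [xw wy wz]]] <-]|z [xz [w [xw wy wz]]]].
  by split; [exact: fl|exists (f w); split; [exact: fl|exact: fh|exact: fh]].
exists (g z); last exact: gK.
rewrite -[x]fK; split; first by exact: gl.
by exists (g w); rewrite -[y]fK; split; [exact: gl|exact: gh|exact: gh].
Qed.

Lemma germ_run_aut (f g : X -> X) x w n : cancel f g -> cancel g f ->
  {homo f : u v / u <= v} -> {homo g : u v / u <= v} ->
  germ_run x w n -> germ_run (f x) (f w) n.
Proof.
move=> fK gK fh gh; have fl := lt_aut fK fh; have gl := lt_aut gK gh.
move=> run w1 xw1 w1w.
have [||w2 [xw2 w2w1 iso]] := run (g w1).
- by rewrite -[x]fK; exact: gl.
- by rewrite -[w]fK; exact: gh.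
exists (f w2); split; [exact: fl|by rewrite -[w1]gK; exact: fh|].
apply: (isolated_run_iso (e := f) (g := g)) iso.
- exact: convex_set_oo.
- exact: convex_set_oo.
- by move=> v /= /andP[xv vw]; rewrite !fl.
- by move=> v /= /andP[xv vw]; rewrite gK -[x]fK -[w2]fK !gl.
- by move=> v v' _ _; exact: fl.
- by move=> v v' _ _; exact: gl.
- move=> v _; split=> nb b; apply: nb; last exact: branching_aut b.
  by rewrite -[v]fK; exact: branching_aut b.
Qed.

(** If the meet m of x and f x were strictly below x, a fixed point between m and
    x would lie below f x as well, against maximality of m. So x <= f x, and
    the same for the inverse. *)
Lemma identity_of_dense_fixed (f g : X -> X) :
  (forall x y : X, exists m, [/\ m <= x, m <= y &
     forall z, z <= x -> z <= y -> z <= m]) ->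
  cancel f g -> cancel g f ->
  {homo f : u v / u <= v} -> {homo g : u v / u <= v} ->
  (forall m x, m < x -> exists y, [/\ m < y, y <= x & f y = y]) ->
  forall x, f x = x.
Proof.
move=> meetX fK gK fh gh dense.
have le_image h x : {homo h : u v / u <= v} ->
    (forall m x, m < x -> exists y, [/\ m < y, y <= x & h y = y]) -> x <= h x.
  move=> hh hd; have [m [mx mh mmax]] := meetX x (h x).
  move: (mx); rewrite le_eqVlt => /predU1P[mE|/hd[y [my yx hy]]].
    by rewrite -{1}mE.
  have : y <= m by apply: mmax => //; rewrite -hy; exact: hh.
  by rewrite (lt_geF my).
move=> x; apply/eqP; rewrite eq_le le_image// andbT.
have: x <= g x; last by move=> /fh; rewrite gK.
apply: le_image => // m z /dense[y [my yz fy]].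
by exists y; split=> //; rewrite -{1}fy fK.
Qed.

End Trees.

Local Open Scope ring_scope.
Local Open Scope classical_set_scope.

(** * Patterns on the negative half-line that encode sets of natural numbers *)

Section Patterns.
Variable R : realType.
Implicit Types (S : set nat) (u a b s t h : R).

Lemma sqrt2_irrational : ~ rational (Num.sqrt 2 : R).
Proof.
move=> /rationalP[a [b ab]].
have s2 : (Num.sqrt 2 : R) ^+ 2 = 2 by rewrite sqr_sqrtr.
have b0 : b != 0%N.
  apply/eqP => b0; move: s2; rewrite ab b0 invr0 mulr0 expr0n /= => /eqP.
  by rewrite eq_sym (pnatr_eq0 R 2).
have bR : (b%:R : R) != 0 by rewrite pnatr_eq0.
have : (`|a| ^ 2 = 2 * b ^ 2)%N.
  apply/eqP; rewrite -(eqr_nat R) natrM !natrX natr_absz -rmorphXn /=.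
  rewrite -[`|a| ^+ 2]normrX ger0_norm ?sqr_ge0// rmorphXn /=.
  by rewrite -s2 ab expr_div_n divfK// expf_neq0.
move=> /(congr1 (logn 2)); rewrite lognM ?expn_gt0 ?lt0n ?b0// !lognX.
by have -> : logn 2 2 = 1%N by []; lia.
Qed.

Lemma irrational_between a b : a < b -> exists2 u, a < u < b & ~ rational u.
Proof.
move=> ab; have : a - Num.sqrt 2 < b - Num.sqrt 2 by lra.
move=> /rat_in_itvoo[q]; rewrite in_itv /= => /andP[q1 q2].
exists (ratr q + Num.sqrt 2); first by apply/andP; split; lra.
move=> [p _ pq]; apply: sqrt2_irrational; exists (p - q) => //.
by rewrite rmorphB /= pq addrC addKr.
Qed.

Lemma rational_between a b : a < b -> exists2 u, a < u < b & rational u.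
Proof.
move=> /rat_in_itvoo[q]; rewrite in_itv /= => /andP[q1 q2].
by exists (ratr q); [rewrite q1 q2|exists q].
Qed.

Lemma finite_gap_left (F : nat -> R) n a b : a < b ->
  exists c, [/\ a <= c, c < b & forall i, (i < n)%N -> ~ (c < F i < b)].
Proof.
move=> ab; elim: n => [|n [c [ac cb Fc]]]; first by exists a.
case: (boolP (c < F n < b)) => [/andP[cF Fb]|nF].
  exists (F n); split=> //; first exact: le_trans (ltW cF).
  move=> i; rewrite ltnS leq_eqVlt => /predU1P[->|/Fc Fi]; first by rewrite ltxx.
  by move=> /andP[i1 i2]; apply: Fi; rewrite i2 (lt_trans cF).
exists c; split=> // i; rewrite ltnS leq_eqVlt => /predU1P[->|/Fc//].
exact/negP.
Qed.

Lemma finite_gap_right (F : nat -> R) n a b : a < b ->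
  exists c, [/\ a < c, c <= b & forall i, (i < n)%N -> ~ (a < F i < c)].
Proof.
move=> ab; have ab' : - b < - a by rewrite ltrN2.
have [c [bc ca Fc]] := finite_gap_left (fun i => - F i) n ab'.
exists (- c); split; [lra|lra|move=> i /Fc Fi /andP[i1 i2]].
by apply: Fi; apply/andP; split; lra.
Qed.

Lemma rationals_not_finite (N : set R) a b n : a < b ->
  (forall u, a < u < b -> rational u -> N u) -> ~ (N #= `I_n).
Proof.
move=> ab sub card; have /finite_seqP[s Ns] : finite_set N by exists n.
have [c [ac cb Fc]] := finite_gap_left (nth 0 s) (size s) ab.
have [u /andP[cu ub] ru] := rational_between cb.
have : N u by apply: sub => //; rewrite ub (le_lt_trans ac).
rewrite Ns /= => us; apply: (Fc (index u s)); first by rewrite index_mem.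
by rewrite nth_index// cu ub.
Qed.

Lemma negative_block u : u < 0 -> exists k : nat,
  (- (k.*2.+2)%:R <= u < - (k.*2.+1)%:R) \/ (- (k.*2.+1)%:R <= u < - (k.*2)%:R).
Proof.
move=> u0; have ex : exists j : nat, - u <= j%:R.
  by exists (Num.bound (- u)); rewrite ltW// archi_boundP//; lra.
case: (ex_minnP ex) => -[|m] mu mmin; first by move: mu; lra.
have mu' : m%:R < - u.
  by rewrite ltNge; apply/negP => /mmin; rewrite ltnn.
move: mu mu'; rewrite -(odd_double_half m); case: (odd m) => /= mu mu'.
  by exists m./2; left; move: mu mu'; rewrite add1n; lra.
by exists m./2; right; move: mu mu'; rewrite add0n; lra.
Qed.

(** The function [logn 2] takes every value on arbitrarily large arguments. Lengths
    outside [S] are replaced by 0, which codes always contain. *)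
Definition run_length S (k : nat) : nat :=
  if `[< S (logn 2 k) >] then logn 2 k else 0%N.

Definition run_point (k i : nat) : R := - (k.*2)%:R - (i.+2)%:R^-1.

(** The blocks of rationals are delimiters: no finite run meets them, and their
    end points are the limit points that delimit the [k]-th run, which consists
    of the points [run_point k i] in the interval (-(2k+1), -2k) between two
    blocks. *)
Definition pattern S : set R := [set u | exists k : nat,
  (rational u /\ - (k.*2.+2)%:R <= u <= - (k.*2.+1)%:R) \/
  (exists2 i, (i < run_length S k)%N & u = run_point k i)].

Lemma run_point_bounds k i : - (k.*2.+1)%:R < run_point k i < - (k.*2)%:R.
Proof.
have k1 : ((k.*2.+1)%:R : R) = (k.*2)%:R + 1 by rewrite natr1.
rewrite /run_point k1.
have h1 : 0 < ((i.+2)%:R : R)^-1 by rewrite invr_gt0.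
have h2 : ((i.+2)%:R : R)^-1 < 1 by rewrite invf_lt1 ?ltr0n// ltr1n.
move: (i.+2%:R^-1) h1 h2 => x h1 h2.
by apply/andP; split; lra.
Qed.

Lemma run_point_inj k : injective (run_point k).
Proof.
move=> i j /addrI/oppr_inj/invr_inj/eqP; rewrite eqr_nat => /eqP; lia.
Qed.

Lemma pattern_rational S u : pattern S u -> rational u.
Proof.
move=> [k [[]//|[i _ ->]]].
exists (- (k.*2)%:R - (i.+2)%:R^-1) => //.
by rewrite /run_point rmorphB rmorphN fmorphV /= !ratr_nat.
Qed.

Lemma pattern_odd_block S k u :
  - (k.*2.+2)%:R <= u <= - (k.*2.+1)%:R -> rational u -> pattern S u.
Proof. by move=> ku ru; exists k; left. Qed.

Lemma pattern_even_block S k u : - (k.*2.+1)%:R < u < - (k.*2)%:R ->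
  pattern S u -> exists2 i, (i < run_length S k)%N & u = run_point k i.
Proof.
move=> /andP[u1 u2] [j [[_ /andP[u3 u4]]|[i ij uij]]].
  have : ((k.*2)%:R : R) < (j.*2.+2)%:R by lra.
  have : ((j.*2.+1)%:R : R) < (k.*2.+1)%:R by lra.
  by rewrite !ltr_nat; lia.
have /andP[] := run_point_bounds j i; rewrite -uij => u3 u4.
have jk : ((k.*2)%:R : R) < (j.*2.+1)%:R by lra.
have kj : ((j.*2)%:R : R) < (k.*2.+1)%:R by lra.
have <- : j = k by move: jk kj; rewrite !ltr_nat; lia.
by exists i.
Qed.

Lemma card_pattern_even_block S k :
  pattern S `&` [set u | - (k.*2.+1)%:R < u < - (k.*2)%:R]
    #= `I_(run_length S k).
Proof.
have -> : pattern S `&` [set u | - (k.*2.+1)%:R < u < - (k.*2)%:R] =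
    run_point k @` `I_(run_length S k).
  apply/seteqP; split=> [u [Pu /pattern_even_block /(_ Pu)[i ? ->]]|_ [i ? <-]].
    by exists i.
  by split; [exists k; right; exists i|exact: run_point_bounds].
by apply: inj_card_eq => i j _ _; exact: run_point_inj.
Qed.

Lemma pattern_gap_left S k a b : - (k.*2.+1)%:R <= a -> a < b ->
    b < - (k.*2)%:R ->
  exists c, [/\ a <= c, c < b & forall u, c < u < b -> ~ pattern S u].
Proof.
move=> ka ab bk; have [c [ac cb Fc]] :=
  finite_gap_left (run_point k) (run_length S k) ab.
exists c; split=> // u /andP[cu ub] /(@pattern_even_block S k)[].
  by apply/andP; split; lra.
by move=> i /Fc + uE; rewrite -uE cu ub; apply.
Qed.

Lemma pattern_gap_right S k a b : - (k.*2.+1)%:R <= a -> a < b ->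
    b <= - (k.*2)%:R ->
  exists c, [/\ a < c, c <= b & forall u, a < u < c -> ~ pattern S u].
Proof.
move=> ka ab bk; have [c [ac cb Fc]] :=
  finite_gap_right (run_point k) (run_length S k) ab.
exists c; split=> // u /andP[au uc] /(@pattern_even_block S k)[].
  by apply/andP; split; lra.
by move=> i /Fc + uE; rewrite -uE au uc; apply.
Qed.

(** The two ends of a run cannot be inside a block of rationals, which would make
    the run infinite, nor in the interior of an intermediate interval, where
    there are no limit points. So they are the ends of such an interval. *)
Lemma pattern_run_sound S L n : S 0%N -> L <= 0 ->
  isolated_run [set u | u < L] (pattern S) n -> S n.
Proof.
move=> S0 L0 [y [z [[/= yL zL yz] [ly rz card]]]].
have y0 : y < 0 by lra.
have [k [/andP[ky yk]|/andP[ky yk]]] := negative_block y0.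
  exfalso; have lt : y < Num.min z (- (k.*2.+1)%:R) by rewrite lt_min yz yk.
  apply: (rationals_not_finite lt _ card) => u.
  rewrite lt_min => /and3P[yu uz uk] ru; split; last by rewrite /= yu uz.
  by apply: (@pattern_odd_block S k) => //; apply/andP; split; lra.
have yE : y = - (k.*2.+1)%:R.
  apply/eqP; case: eqP => // /eqP yk'; exfalso.
  have ky' : - (k.*2.+1)%:R < y by rewrite lt_neqAle eq_sym yk' ky.
  have [c [_ cy Nc]] := pattern_gap_left S (lexx _) ky' yk.
  have [v Nv v1] := ly c (lt_trans cy yL) cy.
  exact: (Nc v).
have zk : z = - (k.*2)%:R.
  apply/eqP; rewrite eq_le; apply/andP; split; rewrite leNgt; apply/negP => kz.
    case: k {ky yk} yE kz => [|k] yE kz; first by move: kz; rewrite double0; lra.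
    rewrite -natr1 in yE; rewrite doubleS in kz yE.
    have lt : - (k.*2.+2)%:R < Num.min z (- (k.*2.+1)%:R).
      by rewrite lt_min kz ltrN2 ltr_nat; lia.
    apply: (rationals_not_finite lt _ card) => u.
    rewrite lt_min => /and3P[yu uz uk] ru; split; last by rewrite /= uz andbT; lra.
    by apply: (@pattern_odd_block S k) => //; apply/andP; split; lra.
  have yz' : - (k.*2.+1)%:R <= z by lra.
  have lt : z < Num.min L (- (k.*2)%:R) by rewrite lt_min zL kz.
  have le : Num.min L (- (k.*2)%:R) <= - (k.*2)%:R by rewrite ge_min lexx orbT.
  have [c [zc + Nc]] := pattern_gap_right S yz' lt le.
  rewrite le_min => /andP[cL _].
  have zc' : z < (z + c) / 2 by lra.
  have [v Nv /andP[v1 v2]] := rz ((z + c) / 2) ltac:(rewrite /=; lra) zc'.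
  by apply: (Nc v) => //; rewrite v1; lra.
have cardE := card_pattern_even_block S k; rewrite -yE -zk in cardE.
have : `I_n #= `I_(run_length S k) by rewrite -(card_eql card).
by move=> /card_eq_II ->; rewrite /run_length; case: asboolP.
Qed.

(** The index [k] is chosen with [logn 2 k = n] and large enough for the [k]-th
    intermediate interval to lie to the left of [L]. *)
Lemma pattern_run_complete S L n : L <= 0 -> S n ->
  isolated_run [set u | u < L] (pattern S) n.
Proof.
move=> L0 Sn; pose j := Num.bound (- L); pose k := (2 ^ n * (j.*2.+1))%N.
have kn : run_length S k = n.
  suff lk : logn 2 k = n by rewrite /run_length lk; case: asboolP.
  rewrite /k lognM ?expn_gt0// pfactorK// (@logn_coprime 2 j.*2.+1) ?addn0//.
  by rewrite coprime2n /= odd_double.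
have p2 : (0 < 2 ^ n)%N by rewrite expn_gt0.
have jk : (j < k.*2)%N by rewrite /k; nia.
have Lj : - L < j%:R by rewrite archi_boundP; lra.
have kL : - (k.*2)%:R < L.
  have : (j%:R : R) < (k.*2)%:R by rewrite ltr_nat.
  by lra.
have k1 : ((k.*2.+1)%:R : R) = (k.*2)%:R + 1 by rewrite natr1.
exists (- (k.*2.+1)%:R), (- (k.*2)%:R); split; first by split=> //=; lra.
split; last by rewrite -kn; exact: card_pattern_even_block.
- move=> y' _ y'k.
  have lt : Num.max y' (- (k.*2.+2)%:R) < - (k.*2.+1)%:R.
    by rewrite gt_max y'k ltrN2 ltr_nat leqnn.
  have [u] := rational_between lt; rewrite gt_max => /andP[/andP[u1 u2] u3] ru.
  exists u; last by rewrite u1 u3.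
  by apply: (@pattern_odd_block S k) => //; rewrite !ltW.
- move=> z' _ z'k.
  have kK : k = k.-1.+1 by rewrite /k; lia.
  have lt : - (k.*2)%:R < Num.min z' (- (k.-1.*2.+1)%:R).
    by rewrite lt_min z'k ltrN2 ltr_nat; lia.
  have [u] := rational_between lt; rewrite lt_min => /and3P[u1 u2 u3] ru.
  exists u; last by rewrite u1 u2.
  apply: (@pattern_odd_block S k.-1) => //.
  by rewrite -doubleS -kK !ltW.
Qed.

(** Just to the right of a point there are either all rationals, so no finite
    run, or no points of the pattern, so no limit points. *)
Lemma pattern_no_run S u : u < 0 -> exists2 c, u < c &
  forall w n, u < w -> w <= c ->
    ~ isolated_run [set v | u < v < w] (pattern S) n.
Proof.
move=> u0; have [k [/andP[ku uk]|/andP[ku uk]]] := negative_block u0.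
  exists (- (k.*2.+1)%:R) => // w n uw wk.
  move=> [y [z [[/= /andP[uy yw] /andP[uz zw] yz] [_ _ card]]]].
  apply: (rationals_not_finite yz _ card) => v /andP[yv vz] rv; split.
    by apply: (@pattern_odd_block S k) => //; apply/andP; split; lra.
  by rewrite /= yv vz.
have [c [uc _ Nc]] := pattern_gap_right S ku uk (lexx _).
exists c => // w n uw wc [y [z [[/= /andP[uy yw] _ _] [ly _ _]]]].
have [v Nv /andP[v1 v2]] := ly ((u + y) / 2) ltac:(rewrite /=; lra) ltac:(lra).
by apply: (Nc v) => //; apply/andP; split; lra.
Qed.

Lemma lt_opp_inv s t : 0 < s -> s < t -> - s^-1 < - t^-1.
Proof. by move=> s0 st; rewrite ltrN2 ltf_pV2 ?posrE// (lt_trans s0). Qed.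

Lemma lt_opp_inv_neg s t : t < 0 -> s < t -> - s^-1 < - t^-1.
Proof. by move=> t0 st; rewrite ltrN2 ltf_nV2 ?negrE// (lt_trans st). Qed.

Lemma opp_invK s : - (- s^-1)^-1 = s.
Proof. by rewrite invrN opprK invrK. Qed.

(** The coordinates u = -1/(s - a) of the heights s in (h, t), for a <= h. *)
Definition window a h t : set R := [set u | u < 0 /\ h < a - u^-1 < t].

Lemma convex_window a h t : convex_set (window a h t).
Proof.
move=> y z v [y0 /andP[y1 y2]] [z0 /andP[z1 z2]] yv vz.
have v0 : v < 0 by apply: lt_trans z0.
have := lt_opp_inv_neg v0 yv; have := lt_opp_inv_neg z0 vz.
by split=> //; apply/andP; split; lra.
Qed.

Lemma window_full a t : a < t -> window a a t = [set u | u < - (t - a)^-1].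
Proof.
move=> at'; have c0 : 0 < t - a by rewrite subr_gt0.
have ci0 : 0 < (t - a)^-1 by rewrite invr_gt0.
apply/seteqP; split=> [u [u0 /andP[_ u2]]|u /= ut].
  have s0 : 0 < - u^-1 by rewrite oppr_gt0 invr_lt0.
  have st : - u^-1 < t - a by lra.
  by have := lt_opp_inv s0 st; rewrite opp_invK.
have L0 : - (t - a)^-1 < 0 by rewrite oppr_lt0.
have := lt_opp_inv_neg L0 ut; rewrite opp_invK => h.
have u0 : u < 0 by apply: lt_trans L0.
have s0 : 0 < - u^-1 by rewrite oppr_gt0 invr_lt0.
by split=> //; apply/andP; split; lra.
Qed.

Lemma window_part a h t : a < h -> h < t ->
  window a h t = [set u | - (h - a)^-1 < u < - (t - a)^-1].
Proof.
move=> ah ht'.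
have c0 : 0 < h - a by rewrite subr_gt0.
apply/seteqP; split=> [u [u0 /andP[u1 u2]]|u /= /andP[u1 u2]].
  have h1 : h - a < - u^-1 by lra.
  have h2 : - u^-1 < t - a by lra.
  have := lt_opp_inv c0 h1; have := lt_opp_inv (lt_trans c0 h1) h2.
  by rewrite opp_invK /= => -> ->.
have c1 : 0 < t - a by lra.
have L0 : - (t - a)^-1 < 0 by rewrite oppr_lt0 invr_gt0.
have u0 : u < 0 by apply: lt_trans L0.
have := lt_opp_inv_neg L0 u2; have := lt_opp_inv_neg u0 u1; rewrite !opp_invK.
by move=> *; split=> //; apply/andP; split; lra.
Qed.

End Patterns.

(** * The tree of histories *)

Section Histories.
Variables (R : realType) (K : Type) (k0 : K) (e : K -> nat -> bool).
Implicit Types (p : R -> K) (s t h : R) (k : K).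

Definition cut p t : R -> K := fun s => if s < t then p s else k0.

Definition upd p t k : R -> K := fun s => if s == t then k else p s.

Definition isolated_jumps p := forall t,
  exists a b, a < t < b /\ forall s, a < s < b -> s != t -> p s = k0.

(** Whether there is a jump with label [k], and the bits of that label. The
    first makes [label_bit] tell all labels from [k0] whatever [e k0] is. *)
Definition label_bit k (m : option nat) : Prop :=
  k <> k0 /\ (if m is Some j then e k j else true).

(** A labelling with isolated jumps is determined by which labels occur in each
    rational interval, as some rational interval isolates any given position. The
    number 0 belongs to every code so that no code is empty. *)
Definition code p : set nat := [set n | n = 0%N \/
  exists (q1 q2 : rat) m s, [/\ n = (pickle (q1, q2, m)).+1,
    ratr q1 < s < ratr q2 & label_bit (p s) m]].

(* The supremum of the empty set is 0, so that the path of a history without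
   jumps starts at the root. *)
Definition last_jump p : R := sup [set s | p s <> k0].

(** The coordinate - 1 / (t - last_jump p) tends to -oo as t approaches the last
    jump from above, which is where the pattern can be decoded. *)
Definition jump_allowed p t : Prop :=
  last_jump p < t /\ ~ pattern (code p) (- (t - last_jump p)^-1).

(** The histories of height [h]: whether a jump is allowed at [s] depends only on
    what happened before [s]. *)
Definition legal h p : Prop := [/\ 0 <= h, isolated_jumps p &
  forall s, p s <> k0 -> [/\ 0 < s, s < h & jump_allowed (cut p s) s]].

Lemma cut_cut p s t : s <= t -> cut (cut p t) s = cut p s.
Proof.
move=> st; apply/funext => r; rewrite /cut; case: ifP => // rs.
by rewrite (lt_le_trans rs st).
Qed.

Lemma cut_legal h p t : legal h p -> h <= t -> cut p t = p.
Proof.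
move=> [_ _ pP] ht; apply/funext => s; rewrite /cut; case: ifPn => // st.
apply/esym; apply: contrapT => /pP[_ sh _].
by rewrite (lt_le_trans sh ht) in st.
Qed.

Lemma legal_outside h p : legal h p -> p h = k0.
Proof. by move=> [_ _ pP]; apply: contrapT => /pP[_]; rewrite ltxx. Qed.

Lemma upd_k0 h p : legal h p -> upd p h k0 = p.
Proof.
move=> hp; apply/funext => s; rewrite /upd; case: eqP => // ->.
by rewrite (legal_outside hp).
Qed.

Lemma cut_upd h p k : legal h p -> cut (upd p h k) h = p.
Proof.
move=> hp; rewrite -[RHS](cut_legal hp (lexx h)); apply/funext => s.
by rewrite /cut /upd; case: ifP => // sh; rewrite lt_eqF.
Qed.

Lemma legal_cut h p t : legal h p -> legal (Num.max 0 t) (cut p t).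
Proof.
move=> [h0 ip pP]; split; first by rewrite le_max lexx.
  move=> r; have [a [b [rab nj]]] := ip r; exists a, b; split=> // s sab sr.
  by rewrite /cut nj// if_same.
move=> s; rewrite {1}/cut; case: ifP => // st /pP[s0 sh fs].
by split=> //; [rewrite lt_max st orbT|rewrite cut_cut// ltW].
Qed.

Lemma last_jump_ge0 h p : legal h p -> 0 <= last_jump p.
Proof.
move=> [h0 _ pP]; rewrite /last_jump.
have [->|/set0P[s ps]] := eqVneq [set s | p s <> k0] set0; first by rewrite sup0.
have [s0 _ _] := pP s ps; apply: le_trans (ltW s0) _.
by apply: ub_le_sup => //; exists h => r /pP[_ /ltW].
Qed.

Lemma last_jump_le h p : legal h p -> last_jump p <= h.
Proof.
move=> [h0 _ pP]; rewrite /last_jump.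
have [->|/set0P ps] := eqVneq [set s | p s <> k0] set0; first by rewrite sup0.
by apply: ge_sup => // s /pP[_ /ltW].
Qed.

Lemma last_jump_upd h p k : legal h p -> k <> k0 -> last_jump (upd p h k) = h.
Proof.
move=> [_ _ pP] kk0.
have uph : upd p h k h <> k0 by rewrite /upd eqxx.
have ub : ubound [set s | upd p h k s <> k0] h.
  move=> s /=; rewrite /upd; case: eqP => [->//|_ /pP[_ sh _]]; exact: ltW.
apply/eqP; rewrite eq_le; apply/andP; split.
  by apply: ge_sup => //; exists h.
by apply: ub_le_sup => //; exists h.
Qed.

(** Appending a jump to a history at its height, and then staying on the
    path. *)
Lemma legal_upd h p k t : legal h p -> h < t -> k = k0 \/ jump_allowed p h ->
  legal t (upd p h k).
Proof.
move=> hp ht; have [->|kk0 [//|fph]] := pselect (k = k0).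
  rewrite upd_k0// => _; case: hp => h0 ip pP; split=> //; first by lra.
  by move=> s /pP[s0 sh fs]; split=> //; apply: lt_trans ht.
have h0 : 0 < h by case: fph => + _; apply: le_lt_trans; exact: last_jump_ge0 hp.
have [_ ip pP] := hp; split; first by lra.
  move=> r; have [a [b [/andP[ar rb] nj]]] := ip r.
  have [rh|rh|->] := ltgtP r h; last first.
  - have [a' [b' [rab' nj']]] := ip h.
    exists a', b'; split=> // s sab sh.
    by rewrite /upd (negbTE sh) nj'.
  - exists (Num.max a h), b; rewrite gt_max ar rh rb; split=> // s.
    rewrite gt_max => /andP[/andP[as' hs] sb] sr.
    by rewrite /upd gt_eqF// nj// as'.
  - exists a, (Num.min b h); rewrite lt_min ar rh rb; split=> // s.
    rewrite lt_min => /and3P[as' sb hs] sr.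
    by rewrite /upd lt_eqF// nj// as'.
move=> s; have [->|sh] := eqVneq s h.
  by move=> _; split=> //; rewrite cut_upd.
rewrite {1}/upd (negbTE sh) => /pP[s0 sh' fs]; split=> //.
  exact: lt_trans ht.
suff -> : cut (upd p h k) s = cut p s by [].
apply/funext => r; rewrite /cut /upd; case: ifP => // rs.
by rewrite lt_eqF// (lt_trans rs).
Qed.

Lemma label_bit_code p1 p2 s m : isolated_jumps p2 -> code p1 `<=` code p2 ->
  label_bit (p1 s) m -> label_bit (p2 s) m.
Proof.
move=> i2 c12 b1; have [a [b [/andP[as' sb] nj]]] := i2 s.
have [q1] := rat_in_itvoo as'; rewrite in_itv /= => /andP[aq1 q1s].
have [q2] := rat_in_itvoo sb; rewrite in_itv /= => /andP[sq2 q2b].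
have : code p1 (pickle (q1, q2, m)).+1.
  by right; exists q1, q2, m, s; rewrite q1s sq2.
move=> /c12[//|[q1' [q2' [m' [s' [[/(pcan_inj pickleK)[]]]]]]]] <- <- <-.
move=> /andP[q1s' s'q2] b2; have [<-//|s's] := eqVneq s' s.
by case: b2 => + _; rewrite nj// (lt_trans aq1) ?(lt_trans s'q2).
Qed.

Lemma label_bit_inj k1 k2 : injective e ->
  (forall m, label_bit k1 m <-> label_bit k2 m) -> k1 = k2.
Proof.
move=> einj b12; have [k1E|k1N] := pselect (k1 = k0).
  rewrite k1E; apply/esym; apply: contrapT => k2N.
  by have /b12[] : label_bit k2 None by [].
have [k2N _] : label_bit k2 None by apply/b12.
apply: einj; apply/funext => j; apply/idP/idP => ej.
  by have /b12[] : label_bit k1 (Some j) by [].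
by have /b12[] : label_bit k2 (Some j) by [].
Qed.

Lemma code_inj p1 p2 : injective e -> isolated_jumps p1 -> isolated_jumps p2 ->
  code p1 = code p2 -> p1 = p2.
Proof.
move=> einj i1 i2 c12; apply/funext => s; apply: label_bit_inj => // m.
by split; apply: label_bit_code => //; rewrite c12.
Qed.

Record point := Point { ht : R; lab : R -> K; point_legal : legal ht lab }.

HB.instance Definition _ := gen_eqMixin point.
HB.instance Definition _ := gen_choiceMixin point.

Implicit Types (x y z w v : point).

Lemma point_eq x y : ht x = ht y -> lab x = lab y -> x = y.
Proof.
by case: x y => [h p l] [h' p' l'] /= hh pp; subst h' p'; rewrite (Prop_irrelevance l l').
Qed.

Lemma cut_lab x : cut (lab x) (ht x) = lab x.
Proof. exact: cut_legal (point_legal x) (lexx _). Qed.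

Definition initial_segment x y : bool :=
  `[< ht x <= ht y /\ lab x = cut (lab y) (ht x) >].

Lemma initial_segment_refl : reflexive initial_segment.
Proof. by move=> x; apply/asboolP; rewrite cut_lab. Qed.

Lemma initial_segment_anti : antisymmetric initial_segment.
Proof.
move=> x y /andP[/asboolP[xy lx] /asboolP[yx ly]].
have hxy : ht x = ht y by apply/eqP; rewrite eq_le xy.
by apply: point_eq => //; rewrite lx hxy cut_lab.
Qed.

Lemma initial_segment_trans : transitive initial_segment.
Proof.
move=> y x z /asboolP[xy lx] /asboolP[yz ly]; apply/asboolP.
by split; [exact: le_trans yz|rewrite lx ly cut_cut].
Qed.

Fact point_display : Order.disp_t. Proof. exact: Order.Disp tt tt. Qed.

HB.instance Definition _ := Order.Le_isPOrder.Build point_display point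
  initial_segment_refl initial_segment_anti initial_segment_trans.

Lemma pleP x y : (x <= y)%O <-> ht x <= ht y /\ lab x = cut (lab y) (ht x).
Proof. by split=> [/asboolP|? //]; last exact/asboolP. Qed.

Lemma pltP x y : (x < y)%O <-> ht x < ht y /\ lab x = cut (lab y) (ht x).
Proof.
rewrite lt_neqAle; split=> [/andP[xy /pleP[hxy lxy]]|[hxy lxy]].
  split=> //; rewrite lt_neqAle hxy andbT; apply: contraNneq xy => hE.
  by apply/eqP/point_eq => //; rewrite lxy hE cut_lab.
apply/andP; split; last by apply/pleP; split=> //; exact: ltW.
by apply: contraTneq hxy => ->; rewrite ltxx.
Qed.

(* Total in [t]: negative heights give the root. *)
Definition at_ht x t : point := Point (legal_cut t (point_legal x)).

Lemma ht_at x t : 0 <= t -> ht (at_ht x t) = t.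
Proof. by move=> t0 /=; apply/max_idPr. Qed.

Lemma ht_ge0 x : 0 <= ht x. Proof. by case: (point_legal x). Qed.

Lemma at_ht_le x t : 0 <= t -> t <= ht x -> (at_ht x t <= x)%O.
Proof. by move=> t0 tx; apply/pleP; rewrite ht_at. Qed.

Lemma ple_common x y z : (x <= z)%O -> (y <= z)%O -> ht x <= ht y -> (x <= y)%O.
Proof.
move=> /pleP[_ lx] /pleP[_ ly] xy; apply/pleP; split=> //.
by rewrite ly cut_cut.
Qed.

Lemma plt_common x y z : (x <= z)%O -> (y <= z)%O -> ht x < ht y -> (x < y)%O.
Proof.
move=> xz yz xy; have /pleP[_ lx] := ple_common xz yz (ltW xy).
by apply/pltP.
Qed.

Lemma eq_common x y z : (x <= z)%O -> (y <= z)%O -> ht x = ht y -> x = y.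
Proof.
move=> xz yz hxy; apply: point_eq => //.
by move: xz yz => /pleP[_ ->] /pleP[_ ->]; rewrite hxy.
Qed.

(** As jumps are isolated, just above [x] the history of [w] records at most the
    jump made at [x] itself. *)
Lemma germ x w : (x < w)%O -> exists2 t1, ht x < t1 <= ht w &
  forall t, ht x < t -> t <= t1 ->
    cut (lab w) t = upd (lab x) (ht x) (lab w (ht x)).
Proof.
move=> /pltP[hxw lx]; have [_ iw _] := point_legal w.
have [a [b [/andP[ax xb] nj]]] := iw (ht x).
have xw1 : ht x < Num.min ((ht x + b) / 2) (ht w).
  by rewrite lt_min hxw andbT; lra.
exists (Num.min ((ht x + b) / 2) (ht w)); first by rewrite xw1 ge_min lexx orbT.
move=> t xt; rewrite le_min => /andP[tb tw]; apply/funext => s.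
rewrite /upd lx /cut; case: eqP => [->|/eqP sx]; first by rewrite xt.
case: ifP => [st|]; case: ifP => // sx'.
- have xs : ht x < s by rewrite lt_neqAle eq_sym sx leNgt sx'.
  by rewrite nj// (lt_trans ax xs); lra.
- by rewrite (lt_trans sx' xt).
Qed.

Lemma lab_le x y z : (x < y)%O -> (y <= z)%O -> lab y (ht x) = lab z (ht x).
Proof. by move=> /pltP[xy _] /pleP[_ ->]; rewrite /cut xy. Qed.

Lemma same_componentP x y z : (x < y)%O -> (x < z)%O ->
  same_component x y z <-> lab y (ht x) = lab z (ht x).
Proof.
move=> xy xz; split=> [[w [xw wy wz]]|lyz].
  by rewrite -(lab_le xw wy) (lab_le xw wz).
have [t1 /andP[xt1 t1y] g1] := germ xy; have [t2 /andP[xt2 t2z] g2] := germ xz.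
have xt : ht x < Num.min t1 t2 by rewrite lt_min xt1.
have t1' : Num.min t1 t2 <= t1 by rewrite ge_min lexx.
have t2' : Num.min t1 t2 <= t2 by rewrite ge_min lexx orbT.
have t0 := le_trans (ht_ge0 x) (ltW xt).
have wy : (at_ht y (Num.min t1 t2) <= y)%O by apply: at_ht_le => //; lra.
exists (at_ht y (Num.min t1 t2)); split=> //.
  by apply: plt_common wy _; [exact: ltW|rewrite ht_at].
apply/pleP; rewrite ht_at//; split; first by lra.
by rewrite /= g1// g2// lyz.
Qed.

(** The labels at the height of [x] classify the components above [x]; labels
    other than [k0] require that a jump be allowed there. *)
Lemma jump_allowed_of_label x y : (x < y)%O -> lab y (ht x) <> k0 -> jump_allowed (lab x) (ht x).
Proof. by move=> /pltP[_ ->]; have [_ _ yP] := point_legal y => /yP[]. Qed.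

Lemma child x k : k = k0 \/ jump_allowed (lab x) (ht x) -> exists w,
  [/\ (x < w)%O, lab w = upd (lab x) (ht x) k & lab w (ht x) = k].
Proof.
move=> xk; have x1 : ht x < ht x + 1 by rewrite ltrDl.
exists (Point (legal_upd (point_legal x) x1 xk)); split=> //=; last first.
  by rewrite /upd eqxx.
by apply/pltP; split=> //=; rewrite (cut_upd _ (point_legal x)).
Qed.

Definition cone x k : set point := [set z | (x < z)%O /\ lab z (ht x) = k].

Lemma componentsE x :
  components x = cone x @` [set k | k = k0 \/ jump_allowed (lab x) (ht x)].
Proof.
have compE y : (x < y)%O ->
    [set z | (x < z)%O /\ same_component x y z] = cone x (lab y (ht x)).
  move=> xy; apply/seteqP; split=> z [xz] => [/same_componentP -> //|lzy].
  by split=> //; apply/same_componentP.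
apply/seteqP; split=> [C [y xy ->]|_ [k /= xk <-]].
  exists (lab y (ht x)); last by rewrite compE.
  have [->|yN] := pselect (lab y (ht x) = k0); first by left.
  by right; exact: jump_allowed_of_label xy yN.
have [w [xw _ wk]] := child xk.
by exists w => //; rewrite compE// wk.
Qed.

Lemma cone_inj x k1 k2 : k1 = k0 \/ jump_allowed (lab x) (ht x) ->
  cone x k1 = cone x k2 -> k1 = k2.
Proof.
move=> /child[w [xw _ wk]] c12.
have : cone x k1 w by [].
by rewrite c12 => -[_ <-].
Qed.

Lemma card_components x : jump_allowed (lab x) (ht x) -> components x #= [set: K].
Proof.
move=> fx; rewrite componentsE (_ : [set k | _] = setT).
  by apply: inj_card_eq => k1 k2 _ _; apply: cone_inj; right.
by apply/seteqP; split=> // k _; right.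
Qed.

Lemma branchingP x : `I_2 #<= [set: K] ->
  branching x <-> jump_allowed (lab x) (ht x).
Proof.
move=> K2; rewrite /branching; split=> [|/card_components]; last first.
  by rewrite card_eq_sym => cK; rewrite -(card_le_eqr cK).
rewrite componentsE => c2; apply: contrapT => nfx; move: c2.
rewrite (_ : [set k | _] = [set k0]); last first.
  by apply/seteqP; split=> [k /= []|k ->] //; left.
rewrite image_set1 => /card_ge2_neq[_ [_ [-> ->]]]; exact.
Qed.

(** On a segment without jumps the history is constant, and heights, in the
    coordinate of the path, carry the non-branching points to the pattern. *)
Lemma isolated_run_segment x w p n :
    `I_2 #<= [set: K] -> (x < w)%O -> last_jump p <= ht x ->
    (forall t, ht x < t -> t < ht w -> cut (lab w) t = p) ->
  isolated_run [set v | x < v < w]%O [set v | ~ branching v] n <->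
  isolated_run (window (last_jump p) (ht x) (ht w)) (pattern (code p)) n.
Proof.
move=> K2 xw; set a := last_jump p => ax wp.
pose f v := - (ht v - a)^-1; pose g u := at_ht w (a - u^-1).
have hx0 := ht_ge0 x.
have segP v : (x < v < w)%O -> [/\ ht x < ht v, ht v < ht w & lab v = p].
  move=> /andP[/pltP[h1 _] /pltP[h2 ->]]; split=> //; exact: wp.
have htg u : window a (ht x) (ht w) u -> ht (g u) = a - u^-1.
  by move=> [u0 /andP[u1 u2]]; rewrite ht_at//; lra.
have fP v : (x < v < w)%O -> window a (ht x) (ht w) (f v) /\ g (f v) = v.
  move=> /[dup] xvw /segP[h1 h2 _].
  have E : a - (f v)^-1 = ht v by rewrite /f opp_invK; lra.
  have v0 := ht_ge0 v.
  split; first by split; [rewrite oppr_lt0 invr_gt0; lra|rewrite E h1].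
  apply: (@eq_common _ _ w); last by rewrite ht_at E.
    by rewrite /g E; apply: at_ht_le => //; exact: ltW.
  by case/andP: xvw => _ /ltW.
have gP u : window a (ht x) (ht w) u -> (x < g u < w)%O /\ f (g u) = u.
  move=> /[dup] wu /htg hg; case: wu => u0 /andP[u1 u2].
  have gw : (g u <= w)%O by apply: at_ht_le; lra.
  split; last by rewrite /f hg [X in X - a]addrC addrK opp_invK.
  apply/andP; split; first by apply: (plt_common (ltW xw) gw); rewrite hg.
  by apply: (plt_common gw (lexx w)); rewrite hg.
have fN v : (x < v < w)%O -> ~ branching v <-> pattern (code p) (f v).
  move=> /segP[h1 h2 vp]; rewrite branchingP// /jump_allowed vp -/a; split.
    move=> nf; apply: contrapT => np; apply: nf; split=> //; lra.
  by move=> pf [].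
have fmono v v' : (x < v < w)%O -> (x < v' < w)%O -> (v < v')%O -> f v < f v'.
  move=> /segP[h1 _ _] /segP[h1' _ _] /pltP[vv' _]; apply: lt_opp_inv; lra.
have gmono u u' : window a (ht x) (ht w) u -> window a (ht x) (ht w) u' ->
    u < u' -> (g u < g u')%O.
  move=> wu wu' uu'; have [/andP[_ gw] _] := gP _ wu.
  have [/andP[_ gw'] _] := gP _ wu'.
  apply: (plt_common (ltW gw) (ltW gw')); rewrite !htg//.
  by rewrite ltrD2l; apply: lt_opp_inv_neg => //; case: wu'.
have gN u : window a (ht x) (ht w) u -> pattern (code p) u <-> ~ branching (g u).
  by move=> /gP[/fN -> ->].
split.
  by apply: (@isolated_run_iso _ _ _ _ _ _ _ _ f g) => //;
     [exact: convex_set_oo|exact: convex_window].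
by apply: (@isolated_run_iso _ _ _ _ _ _ _ _ g f) => //;
   [exact: convex_window|exact: convex_set_oo].
Qed.

(** Just above a jump the coordinate starts from -oo, where the pattern shows
    exactly the runs whose lengths are in the code. *)
Lemma germ_run_side x w n : `I_2 #<= [set: K] -> (x < w)%O ->
    lab w (ht x) <> k0 ->
  germ_run x w n <-> code (upd (lab x) (ht x) (lab w (ht x))) n.
Proof.
move=> K2 xw kN; set p := upd _ _ _.
have pa : last_jump p = ht x by apply: last_jump_upd => //; exact: point_legal.
have [t1 /andP[xt1 t1w] gm] := germ xw.
have x0 := ht_ge0 x.
pose c := at_ht w t1.
have cw : (c <= w)%O by apply: at_ht_le => //; lra.
have hc : ht c = t1 by rewrite ht_at//; lra.
have xc : (x < c)%O by apply: (plt_common (ltW xw) cw); rewrite hc.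
have runE w2 : (x < w2)%O -> (w2 <= c)%O ->
    isolated_run [set v | x < v < w2]%O [set v | ~ branching v] n <->
    isolated_run [set u | u < - (ht w2 - ht x)^-1] (pattern (code p)) n.
  move=> xw2 w2c; have [hw2 lw2] := (pleP _ _).1 w2c.
  have [hx2 _] := (pltP _ _).1 xw2.
  have [_ lw2'] := (pleP _ _).1 (le_trans w2c cw).
  rewrite -window_full// -[X in window X]pa.
  apply: isolated_run_segment => //; first by rewrite pa.
  move=> t xt tw2; rewrite lw2' cut_cut; last exact: ltW.
  by apply: gm => //; lra.
split.
  move=> /(_ c xc cw)[w2 [xw2 w2c /(runE _ xw2 w2c) run]].
  apply: pattern_run_sound run; first by left.
  have [hx2 _] := (pltP _ _).1 xw2.
  by rewrite oppr_le0 invr_ge0; lra.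
move=> pn w1 xw1 w1w; pose w2 := if ht w1 <= ht c then w1 else c.
have [xw2 w2w1 w2c] : [/\ (x < w2)%O, (w2 <= w1)%O & (w2 <= c)%O].
  rewrite /w2; case: (leP (ht w1) (ht c)) => h; split=> //.
    exact: ple_common w1w cw h.
  exact: ple_common cw w1w (ltW h).
exists w2; split=> //; apply/runE => //; apply: pattern_run_complete => //.
have [hx2 _] := (pltP _ _).1 xw2.
by rewrite oppr_le0 invr_ge0; lra.
Qed.

(** Continuing on the same path, the coordinate of [x] is a negative real, and
    the pattern has no runs close above it. *)
Lemma germ_run_main x w n : `I_2 #<= [set: K] -> (x < w)%O ->
    jump_allowed (lab x) (ht x) -> lab w (ht x) = k0 -> ~ germ_run x w n.
Proof.
move=> K2 xw [ax _] kE; pose a := last_jump (lab x).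
have [t1 /andP[xt1 t1w]] := germ xw.
rewrite kE (upd_k0 (point_legal x)) => gm.
have u0 : - (ht x - a)^-1 < 0 by rewrite oppr_lt0 invr_gt0 subr_gt0.
have [c0 uc0 nrun] := pattern_no_run (code (lab x)) u0.
pose c := Num.min c0 (- (t1 - a)^-1).
have tc : - (ht x - a)^-1 < - (t1 - a)^-1 by apply: lt_opp_inv; rewrite /a; lra.
have uc : - (ht x - a)^-1 < c by rewrite lt_min uc0.
have cc0 : c <= c0 by rewrite ge_min lexx.
have ct1 : c <= - (t1 - a)^-1 by rewrite ge_min lexx orbT.
have at1 : 0 < t1 - a by rewrite /a; lra.
have c_lt0 : c < 0 by rewrite (le_lt_trans ct1)// oppr_lt0 invr_gt0.
pose t := a - c^-1.
have xt : ht x < t.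
  by have := lt_opp_inv_neg c_lt0 uc; rewrite opp_invK /t; lra.
have tt1 : t <= t1.
  move: ct1; rewrite le_eqVlt => /predU1P[cE|ct1].
    by rewrite /t cE opp_invK; lra.
  have t10 : - (t1 - a)^-1 < 0 by rewrite oppr_lt0 invr_gt0.
  by have := lt_opp_inv_neg t10 ct1; rewrite opp_invK /t; lra.
have x0 := ht_ge0 x.
have tw : (at_ht w t <= w)%O by apply: at_ht_le; lra.
have htt : ht (at_ht w t) = t by rewrite ht_at//; lra.
have xtw : (x < at_ht w t)%O by apply: (plt_common (ltW xw) tw); rewrite htt.
move=> /(_ _ xtw tw)[w2 [xw2 w2t]].
have [hx2 _] := (pltP _ _).1 xw2.
have [hw2 _] := (pleP _ _).1 w2t; rewrite htt in hw2.
have [_ lw2] := (pleP _ _).1 (le_trans w2t tw).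
have noj s : ht x < s -> s < ht w2 -> cut (lab w2) s = lab x.
  by move=> xs sw2; rewrite lw2 cut_cut ?(ltW sw2)// gm//; lra.
move=> /(isolated_run_segment _ K2 xw2 (ltW ax) noj).
rewrite -/a window_part//; apply: nrun.
  by apply: lt_opp_inv; rewrite /a; lra.
apply: le_trans cc0; rewrite -[c]opp_invK.
have -> : - c^-1 = t - a by rewrite /t; lra.
move: hw2; rewrite le_eqVlt => /predU1P[->//|hw2].
by apply/ltW/lt_opp_inv; rewrite /a; lra.
Qed.

(** The heights with irrational coordinate are dense, and all of them branch. *)
Lemma branching_dense m x : `I_2 #<= [set: K] -> (m < x)%O ->
  exists y, [/\ (m < y)%O, (y <= x)%O & branching y].
Proof.
move=> K2 mx; have [t1 /andP[mt1 t1x] gm] := germ mx.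
set p := upd _ _ _ in gm; pose a := last_jump p.
have am : a <= ht m.
  have [kE|kN] := pselect (lab x (ht m) = k0).
    by rewrite /a /p kE (upd_k0 (point_legal m)); apply: last_jump_le (point_legal m).
  by rewrite /a (last_jump_upd (point_legal m) kN).
pose t0 := (ht m + t1) / 2.
have at0 : 0 < t0 - a by rewrite /t0; lra.
have t01 : t0 - a < t1 - a by rewrite /t0; lra.
have [u /andP[u1 u2] nu] := irrational_between (lt_opp_inv at0 t01).
have t10 : - (t1 - a)^-1 < 0 by rewrite oppr_lt0 invr_gt0; lra.
have u0 : u < 0 by lra.
have := lt_opp_inv_neg u0 u1; have := lt_opp_inv_neg t10 u2.
rewrite !opp_invK => h1 h2.
pose t := a - u^-1.
have mt : ht m < t by rewrite /t; move: h2; rewrite /t0; lra.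
have tt1 : t <= t1 by rewrite /t; lra.
have m0 := ht_ge0 m.
have yx : (at_ht x t <= x)%O by apply: at_ht_le; lra.
have htt : ht (at_ht x t) = t by rewrite ht_at//; lra.
exists (at_ht x t); split=> //.
  by apply: (plt_common (ltW mx) yx); rewrite htt.
apply/branchingP => //; rewrite htt /= gm// /jump_allowed -/a; split; first lra.
by rewrite /t [X in X - a]addrC addrK opp_invK => /pattern_rational.
Qed.

Lemma tree_order_point : tree_order point.
Proof.
split.
  move=> x y z /= yx zx; case: (leP (ht y) (ht z)) => h.
    by left; exact: ple_common yx zx h.
  by right; exact: ple_common zx yx (ltW h).
have rootP : legal 0 (fun _ : R => k0).
  by split=> // t; exists (t - 1), (t + 1); split=> //; apply/andP; split; lra.
exists (Point rootP) => x; apply/pleP; split; first exact: ht_ge0.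
apply/funext => s; rewrite /cut /=; case: ifP => // s0; apply/esym.
have [_ _ xP] := point_legal x; apply: contrapT => /xP[s0' _ _].
by move: s0 s0'; lra.
Qed.

(** The supremum of the heights up to which two histories agree is again such
    a height. *)
Lemma meet_point x y : exists m : point,
  [/\ (m <= x)%O, (m <= y)%O & forall z, (z <= x -> z <= y -> z <= m)%O].
Proof.
pose S := [set t | [/\ 0 <= t, t <= ht x, t <= ht y &
                      cut (lab x) t = cut (lab y) t]].
have x0 := ht_ge0 x; have y0 := ht_ge0 y.
have S0 : S 0.
  split=> //; apply/funext => s; rewrite /cut; case: ifP => // s0.
  have [_ _ xP] := point_legal x; have [_ _ yP] := point_legal y.
  transitivity k0; [|apply/esym]; apply: contrapT.
    by move=> /xP[s0' _ _]; rewrite ltNge ltW in s0.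
  by move=> /yP[s0' _ _]; rewrite ltNge ltW in s0.
have uS t : S t -> t <= sup S.
  by move=> St; apply: ub_le_sup => //; exists (ht x) => r [].
have supS0 : 0 <= sup S by exact: uS.
have Sx : sup S <= ht x by apply: ge_sup; [exists 0|move=> r []].
have Sy : sup S <= ht y by apply: ge_sup; [exists 0|move=> r []].
have SS : cut (lab x) (sup S) = cut (lab y) (sup S).
  apply/funext => s; rewrite /cut; case: ifP => // sS.
  have [t [_ _ _ tE] st] : exists2 t, S t & s < t by apply: sup_gt => //; exists 0.
  by have := congr1 (@^~ s) tE; rewrite /cut st.
have mx := at_ht_le supS0 Sx; exists (at_ht x (sup S)); split=> //.
  by apply/pleP; rewrite ht_at.
move=> z zx zy; apply: (ple_common zx mx); rewrite ht_at//.
move: zx zy => /pleP[zx lzx] /pleP[zy lzy].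
by apply: uS; split=> //; [exact: ht_ge0|rewrite -lzx].
Qed.

Lemma continuous_grading_ht : continuous_grading ht.
Proof.
split; first by move=> x y /pltP[].
move=> x y xy; have x0 := ht_ge0 x.
have segP (u v : point) : (u <= y)%O -> (v <= y)%O -> (ht u <= ht v) = (u <= v)%O.
  move=> uy vy; apply/idP/idP => [uv|/pleP[]//]; exact: ple_common uy vy uv.
split; last first.
  move=> u v; rewrite !inE /= => /andP[_ uy] /andP[_ vy]; exact: segP.
split.
- by move=> z /= /andP[/pleP[xz _] /pleP[zy _]]; rewrite in_itv /= xz.
- move=> u v; rewrite !inE /= => /andP[_ uy] /andP[_ vy] uv; exact: eq_common uy vy uv.
- move=> t /=; rewrite in_itv /= => /andP[xt ty].
  have t0 : 0 <= t by lra.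
  exists (at_ht y t); last exact: ht_at.
  by rewrite /= at_ht_le// andbT -segP ?ht_at ?at_ht_le// ltW.
Qed.

End Histories.

Theorem theorem18 (R : realType) (K : Type)
    (hK2 : `I_2 #<= [set: K]) (hKc : [set: K] #<= [set: nat -> bool]) :
  exists (d : Order.disp_t) (X : porderType d),
    [/\ branchwise_real_tree X R, weakly_uniformly_branching X K,
        rigid X & continuously_gradable X R].
Proof.
have [k0 [k1 [_ _ k01]]] := card_ge2_neq hK2.
have [e einj] : exists e : K -> nat -> bool, injective e.
  have /pcard_leP[f] := hKc; exists f => k k' kk'.
  by apply: (inj (f := f)); rewrite ?inE.
pose X := point R k0 e.
have tX : tree_order X by exact: tree_order_point.
have nX : exists x y : X, (x < y)%O.
  have [_ [r _]] := tX; have [w [rw _ _]] := child (x := r) (or_introl (erefl k0)).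
  by exists r, w.
have gX : continuous_grading (@ht R K k0 e) by exact: continuous_grading_ht.
exists point_display, X; split.
- split=> //; last exact: meet_point.
  by move=> B bB; exact: (branch_interval tX nX gX).
- by move=> x /(branchingP _ hK2); exact: card_components.
- move=> f g fK gK fh gh; apply: (identity_of_dense_fixed _ fK gK fh gh).
    exact: meet_point.
  move=> m x mx; have [y [my yx bry]] := branching_dense hK2 mx.
  exists y; split=> //.
  have fy := (branchingP y hK2).1 bry.
  have [w [yw lw wk]] := child (or_intror fy : k1 = k0 \/ _).
  have yN : lab w (ht y) <> k0 by rewrite wk => /esym.
  have runE n : germ_run y w n <-> germ_run (f y) (f w) n.
    split; first exact: germ_run_aut.
    by rewrite -{2}[y]fK -{2}[w]fK; exact: (germ_run_aut gK fK).
  have fyw : (f y < f w)%O by exact: (lt_aut fK fh).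
  have bfy := (branchingP (f y) hK2).1 (branching_aut fK gK fh gh bry).
  (* Every code contains 0, so runs of length 0 tell side components from the
     continuation of the path. *)
  have fyN : lab (f w) (ht (f y)) <> k0.
    move=> /(germ_run_main (n := 0) hK2 fyw bfy); apply; apply/runE.
    by apply/germ_run_side => //; left.
  (* Both codes are the set of lengths of the runs just above y, towards w, and
     just above f y, towards f w. *)
  have [t1 /andP[yt1 _] gm] := germ yw.
  have [t2 /andP[yt2 _] gm2] := germ fyw.
  have iso z t : isolated_jumps k0 (cut k0 (@lab R K k0 e z) t).
    by have [] := legal_cut t (point_legal z).
  have pE : upd (lab (f y)) (ht (f y)) (lab (f w) (ht (f y))) =
            upd (lab y) (ht y) (lab w (ht y)).
    apply: (code_inj einj).
    + by rewrite -(gm2 t2).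
    + by rewrite -(gm t1).
    + apply/seteqP; split=> n.
        by move=> /(germ_run_side _ hK2 fyw fyN)/runE/(germ_run_side _ hK2 yw yN).
      by move=> /(germ_run_side _ hK2 yw yN)/runE/(germ_run_side _ hK2 fyw fyN).
  have hE : ht (f y) = ht y.
    rewrite -(last_jump_upd (point_legal y) yN) -pE.
    by rewrite (last_jump_upd (point_legal (f y)) fyN).
  apply: point_eq => //.
  rewrite -(cut_upd (lab (f w) (ht (f y))) (point_legal (f y))) pE hE.
  by rewrite (cut_upd _ (point_legal y)).
- by exists (@ht R K k0 e).
Qed.
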